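(* Let $d\in\mathbb{N}$, let $\Omega:=[0,1]^d$, and fix any norm on $\mathbb{R}^d$. Let $$\mathcal{V}_1:=\{f\in C^\infty_{\mathrm{str}}(\Omega,\mathbb{R}^d) : \operatorname{Lip}(f)<1\}.$$ Then for every $f\in\mathcal{V}_1$ the map $f+\operatorname{id}_\Omega$ is contained in $\operatorname{Diff}(\Omega)$. Hence $\mathcal{V}_1\subseteq\kappa(\operatorname{Diff}(\Omega)_0)$, where $\kappa\colon\operatorname{Diff}(\Omega)_0\to C^\infty_{\mathrm{str}}(\Omega,\mathbb{R}^d)$, $\kappa(\phi)=\phi-\operatorname{id}_\Omega$.
   Context: A map on $\Omega=[0,1]^d$ is smooth ($C^\infty$) if it extends to a smooth map on an open subset of $\mathbb{R}^d$ containing $\Omega$. $\operatorname{Diff}(\Omega)$ is the group of all $C^\infty$-diffeomorphisms of $\Omega$, i.e. bijections $\phi\colon\Omega\to\Omega$ such that $\phi$ and $\phi^{-1}$ are smooth. $C^\infty_{\mathrm{str}}(\Omega,\mathbb{R}^d)$ is the space of smooth vector fields $f=(f_1,\dots,f_d)\in C^\infty(\Omega,\mathbb{R}^d)$ that are tangent to the boundary, meaning that for each $j\in\{1,\dots,d\}$, $f_j(x_1,\dots,x_d)=0$ whenever $x_j=0$ or $x_j=1$. It is a closed vector subspace of $C^\infty(\Omega,\mathbb{R}^d)$, the latter carrying the compact-open $C^\infty$-topology (uniform convergence of all partial derivatives on $\Omega$). $\operatorname{Diff}(\Omega)$ carries its topology as an infinite-dimensional Lie group modeled on the Fréchet space $C^\infty_{\mathrm{str}}(\Omega,\mathbb{R}^d)$,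 which is the compact-open $C^\infty$-topology. $\operatorname{Diff}(\Omega)_0$ is the connected component of $\operatorname{id}_\Omega$ in $\operatorname{Diff}(\Omega)$; it is an open subgroup, and it is a known fact that $\kappa\colon\phi\mapsto\phi-\operatorname{id}_\Omega$ maps $\operatorname{Diff}(\Omega)_0$ homeomorphically onto an open subset of $C^\infty_{\mathrm{str}}(\Omega,\mathbb{R}^d)$. $\operatorname{Lip}(f)$ denotes the (smallest) Lipschitz constant of $f\colon\Omega\to\mathbb{R}^d$ with respect to the fixed norm on $\mathbb{R}^d$, used on both domain and range. *)

(* Defs.v *)
From HB Require Import structures.
From mathcomp Require Import all_boot all_order all_algebra.
From mathcomp Require Import all_classical all_reals all_analysis.
From mathcomp Require Import lra.

Set Implicit Arguments.
Unset Strict Implicit.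
Unset Printing Implicit Defensive.

Import Order.TTheory GRing.Theory Num.Theory.
Import numFieldNormedType.Exports.

Local Open Scope classical_set_scope.
Local Open Scope ring_scope.

Section Defs.
Variables (R : realType) (d : nat).
Local Notation E := 'rV[R]_d.

Definition Omega : set E := [set x | forall j, 0 <= x 0 j <= 1].

(* [:: i1; ..; ik] gives the iterated partial derivative d_i1 (.. (d_ik F)). *)
Definition dpart (s : seq 'I_d) (F : E -> E) : E -> E :=
  foldr (fun i G => 'D_(delta_mx 0 i) G) F s.

(* Meaningful for open U. *)
Definition smooth_on (U : set E) (F : E -> E) : Prop :=
  forall (s : seq 'I_d) x, U x ->
    {for x, continuous (dpart s F)} /\
    (forall i, derivable (dpart s F) x (delta_mx 0 i)).

Definition smooth_ext (f : Omega -> E) (F : E -> E) : Prop :=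
  exists U : set E, [/\ open U, Omega `<=` U, smooth_on U F &
    forall x : Omega, F (val x) = f x].

Definition smooth : {pred (Omega -> E)} :=
  fun f => `[< exists F, smooth_ext f F >].

Lemma smoothP (f : Omega -> E) :
  reflect (exists F, smooth_ext f F) (f \in smooth).
Proof. exact: asboolP. Qed.

Lemma dpart_linear a (U : set E) (F G : E -> E) : open U ->
  smooth_on U F -> smooth_on U G ->
  forall s x, U x -> dpart s (a *: F + G) x = a *: dpart s F x + dpart s G x.
Proof.
move=> Uo sF sG; elim=> [//|i s IH] x Ux /=.
have [_ /(_ i) dF] := sF s x Ux; have [_ /(_ i) dG] := sG s x Ux.
rewrite (_ : 'D_(delta_mx 0 i) (dpart s (a *: F + G)) x =
             'D_(delta_mx 0 i) (a *: dpart s F + dpart s G) x).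
  have dZ : derivable (a *: dpart s F) x (delta_mx 0 i) by exact: derivableZ.
  by rewrite (deriveD dZ dG) (deriveZ a dF).
apply: near_eq_derive.
by near=> y; apply: IH; near: y; exact: open_nbhs_nbhs.
Unshelve. all: by end_near. Qed.

Lemma smooth_onP a (U : set E) (F G : E -> E) : open U ->
  smooth_on U F -> smooth_on U G -> smooth_on U (a *: F + G).
Proof.
move=> Uo sF sG s x Ux.
have [cF dF] := sF s x Ux; have [cG dG] := sG s x Ux.
have nE : {near x, dpart s (a *: F + G) =1 a *: dpart s F + dpart s G}.
  near=> y; apply: (dpart_linear a Uo sF sG).
  by near: y; exact: open_nbhs_nbhs.
have cFG : (a *: dpart s F + dpart s G) y @[y --> x] -->
    dpart s (a *: F + G) x.
  rewrite (nbhs_singleton nE).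
  exact: (@cvgD _ _ _ (nbhs x) _ _ _ _ _ (@cvgZl_tmp _ _ _ (nbhs x) _ a _ _ cF)).
split=> [|i].
  by apply: cvg_trans cFG; apply: (@near_eq_cvg _ _ (nbhs x));
     apply: filterS nE => y ->.
apply: near_eq_derivable; last by apply: derivableD (dG i); exact: derivableZ.
by apply: filterS nE => y ->.
Unshelve. all: by end_near. Qed.

Lemma smooth_on_subset (U V : set E) F :
  U `<=` V -> smooth_on V F -> smooth_on U F.
Proof. by move=> UV sF s x /UV; exact: sF. Qed.

Lemma smooth_ext_linear a (f g : Omega -> E) F G :
  smooth_ext f F -> smooth_ext g G -> smooth_ext (a *: f + g) (a *: F + G).
Proof.
move=> [U [Uo OU sF Ff]] [V [Vo OV sG Gg]]; exists (U `&` V); split.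
- exact: openI.
- by move=> x Ox; split; [exact: OU|exact: OV].
- apply: smooth_onP; [exact: openI| |].
    by apply: smooth_on_subset sF => x [].
  by apply: smooth_on_subset sG => x [].
- by move=> x; rewrite -[LHS]/(a *: F (val x) + G (val x)) Ff Gg.
Qed.

Lemma smooth_on_cst (c : E) U : smooth_on U (cst c).
Proof.
suff dE s : exists c' : E, dpart s (cst c) = cst c'.
  move=> s x _; have [c' ->] := dE s.
  by split=> [|i]; [exact: cst_continuous|exact: derivable_cst].
elim: s => [|i s [c' IH]]; first by exists c.
by exists 0; rewrite /= IH; apply/funext => x; exact: derive_cst.
Qed.

Lemma smooth_on_id U : smooth_on U (@id E).
Proof.
suff dE s : dpart s (@id E) = id \/ exists c : E, dpart s (@id E) = cst c.
  move=> s x _; have [->|[c ->]] := dE s.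
    by split=> [|i]; [by move=> A|exact: derivable_id].
  by split=> [|i]; [exact: cst_continuous|exact: derivable_cst].
elim: s => [|i s [IH|[c IH]]]; [by left| |]; right => /=; rewrite IH.
  by exists (delta_mx 0 i); apply/funext => x; exact: derive_id.
by exists 0; apply/funext => x; exact: derive_cst.
Qed.

Lemma smooth_submod_closed : submod_closed smooth.
Proof.
split=> [|a f g /smoothP[F fF] /smoothP[G gG]]; apply/smoothP.
  exists (cst 0), setT; split => //; [exact: openT|exact: smooth_on_cst].
by exists (a *: F + G); exact: smooth_ext_linear.
Qed.

HB.instance Definition _ :=
  GRing.isSubmodClosed.Build R (Omega -> E) smooth smooth_submod_closed.

Record Cinf := MkCinf { Cinf_fun :> Omega -> E; CinfP : Cinf_fun \in smooth }.

HB.instance Definition _ := [isSub for Cinf_fun].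
HB.instance Definition _ := [Choice of Cinf by <:].
HB.instance Definition _ := [SubChoice_isSubLmodule of Cinf by <:].

Definition extension (f : Cinf) : E -> E := sval (cid (smoothP f (CinfP f))).

(* Independent of the chosen extension, see partialE. *)
Definition partial (s : seq 'I_d) (f : Cinf) : Omega -> E :=
  fun x => dpart s (extension f) (val x).

Let interior_Omega : set E := [set x | forall j, 0 < x 0 j < 1].

Let open_interior : open interior_Omega.
Proof.
rewrite openE => x Ox; apply: (@filter_forall _ _ _ (nbhs x)) => j; have /andP[x0 x1] := Ox j.
have cj := @coord_continuous R 1 d 0 j x.
by near=> y; apply/andP; split; near: y;
  [exact: (cvgr_gt _ cj)|exact: (cvgr_lt _ cj)].
Unshelve. all: by end_near. Qed.

Let interior_sub : interior_Omega `<=` Omega.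
Proof. by move=> x Ox j; have /andP[/ltW-> /ltW->] := Ox j. Qed.

Lemma partialE (f : Cinf) F : smooth_ext f F ->
  forall s x, partial s f x = dpart s F (val x).
Proof.
rewrite /partial /extension; case: cid => /= G fG fF s [x /= /set_mem Ox].
case: fF fG => [U [Uo OU sF Ff]] [V [Vo OV sG Gf]].
have eqO t : {in interior_Omega, dpart t G =1 dpart t F}.
  elim: t => [|i t IH] y yO /=.
    have Oy : y \in Omega by apply/mem_set/interior_sub/set_mem.
    by rewrite -[y]/(val (exist _ y Oy : Omega)) Gf Ff.
  apply: near_eq_derive; near=> z; apply/IH/mem_set; near: z.
  by apply: open_nbhs_nbhs; split => //; exact: set_mem.
pose p (t : R) : E := x + t *: (const_mx 2^-1 - x).
have px : p t @[t --> 0^'+] --> x.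
  rewrite -[X in _ --> X]addr0 -(scale0r (const_mx 2^-1 - x)).
  by apply: cvgD; [exact: cvg_cst|apply: cvgZr_tmp; exact: cvg_at_right_filter].
have cG : dpart s G (p t) @[t --> 0^'+] --> dpart s G x.
  by apply: cvg_comp px _; have [] := sG s x (OV _ Ox).
have cF : dpart s F (p t) @[t --> 0^'+] --> dpart s F x.
  by apply: cvg_comp px _; have [] := sF s x (OU _ Ox).
have cG' : dpart s F (p t) @[t --> 0^'+] --> dpart s G x.
  apply: (cvg_trans _ cG); apply: (@near_eq_cvg _ _ (0^'+)).
  near=> t; apply/eqO/mem_set => j; rewrite !mxE.
  have /andP[x0 x1] := Ox j.
  have t0 : 0 < t by near: t; exact: nbhs_right_gt.
  have t1 : t < 1 by near: t; exact: nbhs_right_lt.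
  by apply/andP; split; nra.
exact: (cvg_unique (@norm_hausdorff _ _) cG' cF).
Unshelve. all: by end_near. Qed.

(* The compact-open C^oo topology: uniform convergence on Omega of every
   iterated partial derivative. *)
Definition jet (f : Cinf) : {ptws seq 'I_d -> {uniform Omega -> E}} :=
  fun s => partial s f.

HB.instance Definition _ := Topological.copy Cinf (initial_topology jet).

Definition Cinf_str : set Cinf := [set f : Cinf | forall (x : Omega) (j : 'I_d),
  val x 0 j = 0 \/ val x 0 j = 1 -> f x 0 j = 0].

Definition diffeo : {pred (Omega -> Omega)} := fun phi =>
  `[< exists psi : Omega -> Omega, [/\ cancel phi psi, cancel psi phi,
      (val \o phi : Omega -> E) \in smooth &
      (val \o psi : Omega -> E) \in smooth] >].

Lemma diffeoP (phi : Omega -> Omega) :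
  reflect (exists psi : Omega -> Omega, [/\ cancel phi psi, cancel psi phi,
      (val \o phi : Omega -> E) \in smooth &
      (val \o psi : Omega -> E) \in smooth]) (phi \in diffeo).
Proof. exact: asboolP. Qed.

Record Diff := MkDiff { Diff_fun :> Omega -> Omega; DiffP : Diff_fun \in diffeo }.

HB.instance Definition _ := [isSub for Diff_fun].
HB.instance Definition _ := [Choice of Diff by <:].

Lemma Diff_smooth (phi : Diff) : (val \o phi : Omega -> E) \in smooth.
Proof. by have /diffeoP[psi []] := DiffP phi. Qed.

Definition Diff_Cinf (phi : Diff) : Cinf := MkCinf (Diff_smooth phi).

HB.instance Definition _ := Topological.copy Diff (initial_topology Diff_Cinf).

Lemma diffeo_id : @id Omega \in diffeo.
Proof.
have sid : (val \o @id Omega : Omega -> E) \in smooth.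
  apply/smoothP; exists id, setT.
  by split => //; [exact: openT|exact: smooth_on_id].
by apply/diffeoP; exists id.
Qed.

Definition Diff_id : Diff := MkDiff diffeo_id.

Definition Diff0 : set Diff := connected_component [set: Diff] Diff_id.

Definition kappa (phi : Diff) : Cinf := Diff_Cinf phi - Diff_Cinf Diff_id.

Record is_norm (N : E -> R) : Prop := IsNorm {
  is_norm_triangle : forall x y, N (x + y) <= N x + N y ;
  is_norm_homog : forall a x, N (a *: x) = `|a| * N x ;
  is_norm_eq0 : forall x, N x = 0 -> x = 0 }.

(* Extended-real valued, so that a map that is not Lipschitz gets +oo. *)
Definition Lip (N : E -> R) (f : Omega -> E) : \bar R :=
  ereal_inf [set L%:E | L in [set L : R | 0 <= L /\
    forall x y, N (f x - f y) <= L * N (val x - val y)]].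

Definition V1 (N : E -> R) : set Cinf :=
  [set f : Cinf | Cinf_str f /\ (Lip N f < 1)%E].

End Defs.

Arguments Diff_id : clear implicits.
Arguments Diff0 : clear implicits.

(* Main.v *)
Require Import Defs.
From HB Require Import structures.
From mathcomp Require Import all_boot all_order all_algebra.
From mathcomp Require Import all_classical all_reals all_analysis.
From mathcomp Require Import ring lra.

Set Implicit Arguments.
Unset Strict Implicit.
Unset Printing Implicit Defensive.

Import Order.TTheory GRing.Theory Num.Theory.
Import numFieldNormedType.Exports.

Local Open Scope classical_set_scope.
Local Open Scope ring_scope.

(** Write [phi = id + f].  For the sup norm, tangency and [Lip f < 1] give
    [|f_j x| <= c |x_j|] and [|f_j x| <= c |x_j - 1|] with [c < 1], so [phi]
    preserves the cube and its faces, and surjectivity is a fixed point of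
    [x |-> clip (y - f x)].  A general norm is reduced to this case by writing
    [id + f] as a composition of many small perturbations of the identity.

    For smoothness of the inverse, an extension [F] of [f] is compared with its
    composition with a dilation about the centre of the cube: this shows that
    [F] is still a contraction on a slightly larger open cube [W].  There
    [id + F] is injective and open with invertible derivative, and every
    partial derivative of [h o (id + F)^-1] is again of the form
    [g o (id + F)^-1], where [h] and [g] range over the rational expressions
    in the partial derivatives of [F].

    Finally [V1] is star-shaped about [0], so [t |-> id + t f] joins [id] to
    [phi] in the diffeomorphism group. *)

(** * Epsilon-delta forms of neighbourhoods and continuity *)

Lemma near_rVP (R : realType) d (x : 'rV[R]_d) (P : set 'rV[R]_d) :
  nbhs x P <-> exists2 r, 0 < r & forall y, `|x - y| < r -> P y.
Proof.
split=> [/(@nbhs_ballP R 'rV[R]_d)[r/= r0 rP]|[r r0 rP]].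
  by exists r => // y xy; apply: rP; rewrite -ball_normE.
apply/(@nbhs_ballP R 'rV[R]_d); exists r => // y.
by rewrite -ball_normE; exact: rP.
Qed.

Lemma continuous_rVP (R : realType) d (V : normedModType R)
    (f : 'rV[R]_d -> V) (x : 'rV[R]_d) :
  {for x, continuous f} <->
  forall e, 0 < e ->
    exists2 r, 0 < r & forall y, `|x - y| < r -> `|f x - f y| < e.
Proof.
split=> [fx e e0|fx].
  by apply/near_rVP; exact: (@cvgr_dist_lt _ _ _ (nbhs x) _ f (f x) fx _ e0).
apply/(@cvgrPdist_lt _ _ _ (nbhs x)) => e e0.
by apply/near_rVP; exact: fx.
Qed.

Lemma continuous_within_rVP (R : realType) d (V : normedModType R)
    (K : set 'rV[R]_d) (f : 'rV[R]_d -> V) :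
  (forall x, K x -> forall e, 0 < e ->
    exists2 r, 0 < r & forall y, K y -> `|x - y| < r -> `|f x - f y| < e) ->
  {within K, continuous f}.
Proof.
move=> fK; apply/subspace_continuousP => x Kx.
apply/cvgrPdist_lt => e e0; have [r r0 rP] := fK x Kx e e0.
by apply/(@near_rVP R d); exists r => // y xy Ky; exact: rP.
Qed.

(** * Arbitrary norms: equivalence with the sup norm, and fixed points of contractions *)

Section Norms.
Variables (R : realType) (d : nat) (N : 'rV[R]_d -> R).
Hypothesis hN : is_norm N.
Local Notation E := 'rV[R]_d.

Lemma is_norm0 : N 0 = 0.
Proof. by rewrite -(scale0r 0) (is_norm_homog hN) normr0 mul0r. Qed.

Lemma is_normN x : N (- x) = N x.
Proof. by rewrite -scaleN1r (is_norm_homog hN) normrN1 mul1r. Qed.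

Lemma is_norm_ge0 x : 0 <= N x.
Proof.
have := is_norm_triangle hN x (- x); rewrite subrr is_norm0 is_normN; lra.
Qed.

Lemma is_norm_distC x y : N (x - y) = N (y - x).
Proof. by rewrite -is_normN opprB. Qed.

(** Reverse triangle inequality. For [L < 1] it makes [id + F] injective with a Lipschitz inverse
    whenever [F] contracts by [L]. *)
Lemma expansive_add L x y u v : N (u - v) <= L * N (x - y) ->
  (1 - L) * N (x - y) <= N ((x + u) - (y + v)).
Proof.
have := is_norm_triangle hN ((x + u) - (y + v)) (- (u - v)).
rewrite is_normN (_ : x + u - (y + v) - _ = x - y); last first.
  by rewrite opprD addrACA addrK.
by lra.
Qed.

Lemma is_norm_sum (I : Type) (r : seq I) (F : I -> E) :
  N (\sum_(i <- r) F i) <= \sum_(i <- r) N (F i).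
Proof.
elim: r => [|i r IH]; first by rewrite !big_nil is_norm0.
by rewrite !big_cons (le_trans (is_norm_triangle hN _ _))// lerD2l.
Qed.

Lemma norm_coord_le (x : E) j : `|x 0 j| <= `|x|.
Proof.
rewrite [leRHS]/Num.Def.normr/= mx_normrE.
exact: (le_bigmax _ (fun ij : 'I_1 * 'I_d => `|x ij.1 ij.2|) (0, j)).
Qed.

Lemma rV_norm_leP (x : E) c :
  0 <= c -> (`|x| <= c) <-> (forall j, `|x 0 j| <= c).
Proof.
move=> c0; split=> [xc j|xc]; first exact: le_trans (norm_coord_le x j) xc.
rewrite /Num.Def.normr/= mx_normrE bigmax_le// => -[i j] _ /=.
by rewrite ord1.
Qed.

Lemma is_norm_le_norm : exists2 C, 0 < C & forall x, N x <= C * `|x|.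
Proof.
(* The summand [1] keeps the constant positive when [d = 0]. *)
exists (1 + \sum_(i < d) N (delta_mx 0 i)).
  by rewrite ltr_wpDr// sumr_ge0// => i _; exact: is_norm_ge0.
move=> x; rewrite {1}(row_sum_delta x) (le_trans (is_norm_sum _ _))//.
rewrite mulrDl mul1r ler_wpDl// mulr_suml ler_sum// => i _.
rewrite (is_norm_homog hN) mulrC ler_wpM2l ?is_norm_ge0//.
exact: norm_coord_le.
Qed.

Lemma is_norm_dist x y : `|N x - N y| <= N (x - y).
Proof.
rewrite ler_norml; apply/andP; split.
  rewrite lerBrDl lerBlDr is_norm_distC.
  by have := is_norm_triangle hN (y - x) x; rewrite subrK addrC.
by have := is_norm_triangle hN (x - y) y; rewrite subrK lerBlDr.
Qed.

Lemma is_norm_continuous : continuous (N : E -> R).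
Proof.
have [C C0 NC] := is_norm_le_norm.
move=> x; apply/continuous_rVP => e e0; exists (C^-1 * e) => [|y].
  by rewrite mulr_gt0// invr_gt0.
rewrite ltr_pdivlMl// => xy.
by rewrite (le_lt_trans (is_norm_dist _ _))// (le_lt_trans (NC _)).
Qed.

Lemma compact_closed_ballrV (c : E) r : compact [set x : E | `|c - x| <= r].
Proof.
apply: bounded_closed_compact; last exact: (@closed_closed_ball_ R E c r).
exists (r + `|c|); split; first exact: num_real.
move=> M rM x /= xc; apply: le_trans (ltW rM).
by rewrite -[x](subrK c) (le_trans (ler_normD _ _))// lerD2r distrC.
Qed.

(** On the sup-norm unit sphere, which is compact, [N] attains a positive minimum; its inverse
    serves as [C] by homogeneity. *)
Lemma norm_le_is_norm : exists2 C, 0 < C & forall x, `|x| <= C * N x.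
Proof.
have [[x0 nx0]|S0] := pselect (exists x : E, `|x| = 1).
  have cS : compact [set x : E | `|x| = 1].
    apply: subclosed_compact (@compact_closed_ballrV 0 1) _; last first.
      by move=> x /= x1; rewrite sub0r normrN x1.
    apply: (@closed_comp E R (fun x : E => `|x|) [set t | t = 1]).
      by move=> x _; exact: norm_continuous.
    exact: closed_eq.
  have [c /set_mem/= c1 cmin] := EVT_min_rV (ex_intro _ x0 nx0) cS
      (continuous_subspaceT is_norm_continuous).
  have Nc0 : 0 < N c.
    rewrite lt_neqAle is_norm_ge0 andbT eq_sym.
    apply/eqP => /(is_norm_eq0 hN) c0; move: c1; rewrite c0 normr0 => /eqP.
    by rewrite eq_sym oner_eq0.
  exists (N c)^-1; first by rewrite invr_gt0.
  move=> x; rewrite ler_pdivlMl// mulrC.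
  have [->|x_neq0] := eqVneq x 0; first by rewrite is_norm0 normr0 mul0r.
  have nx : 0 < `|x| by rewrite normr_gt0.
  have := cmin (`|x|^-1 *: x); rewrite (is_norm_homog hN) normfV normr_id.
  rewrite ler_pdivlMl//; apply; apply/mem_set => /=.
  by rewrite normrZ normfV normr_id mulVf// gt_eqF.
(* An empty unit sphere means that the space is zero. *)
exists 1 => // x; suff -> : x = 0 by rewrite normr0 is_norm0 mulr0.
apply/eqP/negP => /negP x_neq0; apply: S0; exists (`|x|^-1 *: x).
by rewrite normrZ normfV normr_id mulVf// normr_eq0.
Qed.

(* The displacement [N (x - T x)] attains its minimum, and applying [T]
   decreases it unless it vanishes. *)
Lemma contraction_fixed_point (K : set E) (T : E -> E) c :
  K !=set0 -> compact K -> {homo T : x / K x} -> c < 1 ->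
  (forall x y, K x -> K y -> N (T x - T y) <= c * N (x - y)) ->
  exists2 x, K x & T x = x.
Proof.
move=> K0 cK TK c1 TN.
have [C C0 NC] := is_norm_le_norm; have [C' C'0 CN] := norm_le_is_norm.
have cT : {within K, continuous (fun x => N (x - T x))}.
  apply: continuous_within_rVP => x Kx e e0.
  (* In the sup norm [x - T x] varies by at most [1 + C' |c| C] times the variation of [x]; the
     factor [C] passes to [N]. The absolute value is there because [c] may be negative. *)
  exists ((C * (1 + C' * `|c| * C))^-1 * e) => [|y Ky].
    by rewrite mulr_gt0// invr_gt0 mulr_gt0// ltr_pwDl// !mulr_ge0// ltW.
  rewrite ltr_pdivlMl; last by rewrite mulr_gt0// ltr_pwDl// !mulr_ge0// ltW.
  apply: le_lt_trans; rewrite (le_trans (is_norm_dist _ _))//.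
  rewrite (le_trans (NC _))// -[leRHS]mulrA ler_pM2l// mulrDl mul1r.
  rewrite opprD addrACA -opprD (le_trans (ler_normB _ _))// lerD2l -!mulrA.
  rewrite (le_trans (CN _))// ler_pM2l// (le_trans (TN _ _ Kx Ky))//.
  rewrite (le_trans (ler_wpM2r (is_norm_ge0 _) (ler_norm c)))//.
  by rewrite ler_wpM2l.
have [x /set_mem Kx xmin] := EVT_min_rV K0 cK cT.
exists x => //; apply/eqP; rewrite -subr_eq0 -oppr_eq0 opprB; apply/eqP.
apply: (is_norm_eq0 hN).
have := le_trans (xmin _ (mem_set (TK _ Kx))) (TN _ _ Kx (TK _ Kx)).
have := is_norm_ge0 (x - T x); set t := N _ => t0 tct.
by apply/eqP; rewrite eq_le t0 andbT; nra.
Unshelve. all: by end_near. Qed.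

End Norms.

Lemma is_norm_normr (R : realType) d : is_norm (fun x : 'rV[R]_d => `|x|).
Proof.
split; [exact: ler_normD|exact: normrZ|by move=> x /eqP; rewrite normr_eq0 => /eqP].
Qed.

(** Nearest-point retraction of the line onto [[0, 1]]. It keeps the fixed-point map inside the
    cube, and later extends a path parametrized by [[0, 1]] to all real times. *)
Definition clip01 (R : realType) (t : R) : R := Num.max 0 (Num.min 1 t).

Lemma clip01_itv (R : realType) (t : R) : 0 <= clip01 t <= 1.
Proof. by rewrite le_max lexx ge_max ler01 ge_min lexx. Qed.

Lemma clip01_dist (R : realType) (s t : R) :
  `|clip01 s - clip01 t| <= `|s - t|.
Proof.
rewrite ler_norml; have /andP[] : - `|s - t| <= s - t <= `|s - t|.
  by rewrite -ler_norml.
have := normr_ge0 (s - t); rewrite /clip01; move: `|s - t| => u u0 u1 u2.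
apply/andP; case: (leP 1 t) => ?; case: (leP 1 s) => ?;
  rewrite ?(max_r ler01); case: (leP 0 s) => ?; case: (leP 0 t) => ?; split; lra.
Qed.

(** * Bijectivity of [id + F] on the cube *)

Section CubeBijection.
Variables (R : realType) (d : nat).
Local Notation E := 'rV[R]_d.
Local Notation O := (@Omega R d).

Definition tangent (h : E -> E) := forall x, O x ->
  forall j, x 0 j = 0 \/ x 0 j = 1 -> h x 0 j = 0.

Lemma OmegaE x : O x <-> `|const_mx 2^-1 - x| <= 2^-1.
Proof.
rewrite rV_norm_leP ?invr_ge0//; split => Ox j; have := Ox j; rewrite !mxE.
  by move=> /andP[x0 x1]; rewrite ler_norml; apply/andP; split; lra.
by rewrite ler_norml => /andP[x0 x1]; apply/andP; split; lra.
Qed.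

Lemma Omega_compact : compact O.
Proof.
rewrite (_ : O = [set x : E | `|const_mx 2^-1 - x| <= 2^-1]).
  exact: compact_closed_ballrV.
by apply/funext => x; apply/propext; exact: OmegaE.
Qed.

Lemma Omega_nonempty : O !=set0.
Proof. by exists 0 => j; rewrite mxE lexx ler01. Qed.

(** Compare [x] with its projection [x'] to the face where coordinate [j] equals [v]: [h_j] vanishes
    at [x'], and the sup distance from [x] to [x'] is [|x_j - v|]. *)
Lemma tangent_coord_le (h : E -> E) c x j v : 0 <= c -> tangent h ->
  (forall x y, O x -> O y -> `|h x - h y| <= c * `|x - y|) ->
  v = 0 \/ v = 1 -> O x -> `|h x 0 j| <= c * `|x 0 j - v|.
Proof.
move=> c0 th hL v01 Ox; pose x' : E := \row_k (if k == j then v else x 0 k).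
have Ox' : O x'.
  move=> k; rewrite mxE; case: ifP => _; last exact: Ox.
  by case: v01 => ->; rewrite lexx ler01.
have x'j : x' 0 j = v by rewrite mxE eqxx.
have hx' : h x' 0 j = 0 by apply: th => //; rewrite x'j.
have -> : h x 0 j = (h x - h x') 0 j by rewrite !mxE hx' subr0.
rewrite (le_trans (norm_coord_le _ _))// (le_trans (hL _ _ Ox Ox'))//.
rewrite ler_wpM2l//; apply/rV_norm_leP => // k; rewrite !mxE.
by case: eqP => [->//|_]; rewrite subrr normr0.
Qed.

(** The second clause says that preimages of faces lie in the same faces. This direction makes
    [F o psi] tangent again when [psi] inverts [phi]. *)
Definition face_preserving (phi : E -> E) := forall x, O x -> O (phi x) /\
  forall j, (phi x 0 j = 0 -> x 0 j = 0) /\ (phi x 0 j = 1 -> x 0 j = 1).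

(** The two bounds of [tangent_coord_le] place [x_j + h_j x] between [(1 - c) x_j] and
    [1 - (1 - c) (1 - x_j)]. *)
Lemma face_preserving_sup (h : E -> E) c : 0 <= c < 1 -> tangent h ->
  (forall x y, O x -> O y -> `|h x - h y| <= c * `|x - y|) ->
  face_preserving (fun x => x + h x).
Proof.
move=> /andP[c0 c1] th hL x Ox.
have h0 j := tangent_coord_le j c0 th hL (or_introl erefl) Ox.
have h1 j := tangent_coord_le j c0 th hL (or_intror erefl) Ox.
have ineq (t s : R) : 0 <= t <= 1 -> `|s| <= c * `|t - 0| ->
    `|s| <= c * `|t - 1| ->
    [/\ 0 <= t + s <= 1, t + s = 0 -> t = 0 & t + s = 1 -> t = 1].
  move=> /andP[t0 t1]; rewrite subr0 (ger0_norm t0) (@ler0_norm _ (t - 1)) ?subr_le0//.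
  rewrite !ler_norml => /andP[s1 s2] /andP[s3 s4].
  by split=> [|ts|ts]; [apply/andP; split|..]; nra.
split=> [|] j; rewrite !mxE; have [] := ineq _ _ (Ox j) (h0 j) (h1 j); by [].
Qed.

Lemma surjective_sup (h : E -> E) c : 0 <= c < 1 -> tangent h ->
  (forall x y, O x -> O y -> `|h x - h y| <= c * `|x - y|) ->
  forall y, O y -> exists2 x, O x & x + h x = y.
Proof.
move=> /andP[c0 c1] th hL y Oy.
pose T x : E := \row_j clip01 (y 0 j - h x 0 j).
have [|x z Ox Oz|x Ox Tx] := contraction_fixed_point (is_norm_normr R d)
    Omega_nonempty Omega_compact (T := T) _ c1.
- by move=> x _ j; rewrite mxE clip01_itv.
- apply: le_trans (hL _ _ Ox Oz); apply/rV_norm_leP => // j; rewrite !mxE.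
  rewrite (le_trans (clip01_dist _ _))//.
  rewrite (_ : y 0 j - h x 0 j - (y 0 j - h z 0 j) = - (h x - h z) 0 j).
    by rewrite normrN norm_coord_le.
  by rewrite !mxE; lra.
exists x => //; apply/rowP => j; rewrite !mxE.
have := congr1 (fun z : E => z 0 j) Tx; rewrite mxE /clip01.
(* Where clipping acts, [x_j] is an endpoint, so [h_j x = 0] by tangency. Since [y_j] lies in
   [[0, 1]], the equation then holds anyway or the case is impossible. *)
have /andP[y0 y1] := Oy j; have thj := th x Ox j.
have [y1h|y1h] := leP 1 (y 0 j - h x 0 j).
  rewrite max_r ?ler01// => /esym xj.
  by have := thj (or_intror xj); lra.
have [y0h|y0h] := leP 0 (y 0 j - h x 0 j); first by lra.
by move=> /esym xj; have := thj (or_introl xj); lra.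
Qed.

Section general_norm.
Variables (N : E -> R) (hN : is_norm N) (F : E -> E) (L : R).
Hypotheses (L01 : 0 <= L < 1) (tF : tangent F).
Hypothesis FL : forall x y, O x -> O y -> N (F x - F y) <= L * N (x - y).

Lemma expansive_id_add t x y : 0 <= t <= 1 -> O x -> O y ->
  (1 - L) * N (x - y) <= N ((x + t *: F x) - (y + t *: F y)).
Proof.
move=> /andP[t0 t1] Ox Oy; apply: (expansive_add hN).
rewrite -scalerBr (is_norm_homog hN) ger0_norm// (le_trans _ (FL Ox Oy))//.
by rewrite ler_piMl// (is_norm_ge0 hN).
Qed.

(* For a general norm, tangency gives no direct control of the coordinates of
   [F]. The map [id + s F] is reached in small steps: if [id + t F] is bijective
   with inverse [psi], then [id + s F = (id + (s - t) (F o psi)) o (id + t F)],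
   and for [s - t] small, uniformly in [t], the left factor is a perturbation of
   the identity by a contraction for the sup norm. *)
Lemma cube_bijective : (forall x, O x -> O (x + F x)) /\
  forall y, O y -> exists2 x, O x & x + F x = y.
Proof.
have /andP[L0 L1] := L01.
have [C C0 NC] := is_norm_le_norm hN; have [C' C'0 CN] := norm_le_is_norm hN.
(* [C' L (1 - L)^-1 C] bounds the sup-norm Lipschitz constant of [F o psi] at every stage, because
   the expansion factor [1 - L] is the same for all [k]. Dividing by [n] brings it down to [1/2]. *)
have [n [n0 nK]] : exists n : nat, (0 < n)%N /\
    n%:R^-1 * (C' * (L * ((1 - L)^-1 * C))) <= 2^-1 :> R.
  set K := C' * _; have K0 : 0 <= K.
    by rewrite !mulr_ge0// ?ltW// ?invr_gt0 ?subr_gt0.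
  exists (Num.truncn (2 * K)).+1; split => //.
  rewrite ler_pdivrMl// mulrC ler_pdivlMl//.
  by rewrite ltW// truncnS_gt.
have nR : (n%:R : R) != 0 by rewrite pnatr_eq0 -lt0n.
pose phi k x := x + (k%:R / n%:R) *: F x.
suff H k : (k <= n)%N -> face_preserving (phi k) /\
    forall y, O y -> exists2 x, O x & phi k x = y.
  have [fn sn] := H n (leqnn n); rewrite /phi divff// in fn sn.
  split=> [x Ox|y /sn[x Ox xy]]; first by have [] := fn _ Ox; rewrite scale1r.
  by exists x => //; rewrite -xy scale1r.
elim: k => [_|k IH kn].
  have phi0 x : phi 0%N x = x by rewrite /phi mul0r scale0r addr0.
  by split=> [x Ox|y Oy]; [rewrite phi0|exists y].
have [fk sk] := IH (ltnW kn).
(* [psi] is the inverse of [phi k] on the cube; its values elsewhere are irrelevant. *)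
have /choice[psi psiP] : forall y, exists x, O y -> O x /\ phi k x = y.
  move=> y.
  have [/sk[x Ox xy]|nOy] := pselect (O y); first by exists x.
  by exists 0 => /nOy.
have kn1 : 0 <= (k%:R / n%:R : R) <= 1.
  by rewrite divr_ge0//= ler_pdivrMr ?ltr0n// mul1r ler_nat ltnW.
have phi_exp x y (Ox : O x) (Oy : O y) := expansive_id_add kn1 Ox Oy.
have psiK x : O x -> psi (phi k x) = x.
  move=> Ox; have [Ofx _] := fk _ Ox; have [Opx ppx] := psiP _ Ofx.
  apply/eqP; rewrite -subr_eq0; apply/eqP/(is_norm_eq0 hN).
  have := phi_exp _ _ Opx Ox; rewrite -!/(phi k _) ppx subrr (is_norm0 hN).
  by have := is_norm_ge0 hN (psi (phi k x) - x); nra.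
pose h y := n%:R^-1 *: F (psi y).
have th : tangent h.
  move=> y Oy j yj; rewrite /h mxE tF ?mulr0//; first by have [] := psiP _ Oy.
  have [Opy py] := psiP _ Oy; have [_ /(_ j)[f0 f1]] := fk _ Opy.
  by case: yj => yj; [left; apply: f0|right; apply: f1]; rewrite py.
have hL y z : O y -> O z -> `|h y - h z| <= 2^-1 * `|y - z|.
  move=> Oy Oz; have [Opy py] := psiP _ Oy; have [Opz pz] := psiP _ Oz.
  rewrite -scalerBr normrZ ger0_norm ?invr_ge0//.
  apply: le_trans (ler_wpM2r (normr_ge0 (y - z)) nK); rewrite -mulrA.
  rewrite ler_wpM2l ?invr_ge0// (le_trans (CN _))// -!mulrA ler_pM2l//.
  rewrite (le_trans (FL Opy Opz))// ler_wpM2l// ler_pdivlMl ?subr_gt0//.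
  by rewrite (le_trans (phi_exp _ _ Opy Opz))// -!/(phi k _) py pz NC.
have c01 : 0 <= (2^-1 : R) < 1 by lra.
have fh := face_preserving_sup c01 th hL; have sh := surjective_sup c01 th hL.
have phiS x : O x -> phi k.+1 x = phi k x + h (phi k x).
  move=> Ox; rewrite /h psiK// /phi -addrA -scalerDl.
  by rewrite -natr1 mulrDl mul1r.
split=> [x Ox|y /sh[z Oz zy]].
  have [Opx fx] := fk _ Ox; have [Ohx fhx] := fh _ Opx.
  rewrite phiS//; split => // j; have [fx0 fx1] := fx j.
  by have [fhx0 fhx1] := fhx j; split=> [/fhx0|/fhx1].
have [x Ox xz] := sk _ Oz; exists x => //.
by rewrite phiS// xz.
Qed.

End general_norm.
End CubeBijection.

(** * Differentiability from continuous partial derivatives *)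

Lemma is_diff_littleo (R : realType) (V W : normedModType R) (f : V -> W)
    (L : {linear V -> W}) (x : V) : continuous L ->
  (forall e : R, 0 < e -> \forall v \near 0, `|f (v + x) - f x - L v| <= e * `|v|) ->
  is_diff x f L.
Proof.
move=> cL fL; have fE : f \o shift x = cst (f x) + L +o_ 0 id.
  apply/eqaddoP => e e0; apply: filterS (fL e e0) => v.
  by rewrite !fctE/= opprD addrA.
have dfL := diff_unique cL fE.
by split=> //; apply/diff_locallyP; rewrite dfL.
Qed.

Section C1.
Variables (R : realType) (d : nat).
Local Notation E := 'rV[R]_d.
Local Notation e_ i := (delta_mx 0 i : E).

Lemma is_derive_line (V : normedModType R) (h : E -> V) (p v : E) (s : R) :
  derivable h (s *: v + p) v ->
  is_derive s 1 (fun t : R => h (t *: v + p)) ('D_v h (s *: v + p)).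
Proof.
have eqf : (fun k : R => k^-1 *: (((fun t => h (t *: v + p)) \o shift s) (k *: 1) -
      h (s *: v + p))) =
    (fun k : R => k^-1 *: ((h \o shift (s *: v + p)) (k *: v) - h (s *: v + p))).
  by apply/funext => k /=; rewrite [k%:A]mulr1 scalerDl addrA.
by move=> dh; split; rewrite /derivable /derive eqf.
Qed.

Lemma derive_line_le (h : E -> R) (p v : E) (t eta : R) :
  (forall s : R, 0 <= s <= 1 -> derivable h ((s * t) *: v + p) v /\
     `|'D_v h ((s * t) *: v + p)| <= eta) ->
  `|h (t *: v + p) - h p| <= eta * `|t|.
Proof.
have [->|t0] := eqVneq t 0; first by rewrite scale0r add0r subrr !normr0 mulr0.
(* Reparametrizing the segment by [[0, 1]] treats both signs of [t] at once. *)
move=> dh; pose g (s : R) : R := h (s *: (t *: v) + p).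
have dg (s : R) : 0 <= s <= 1 ->
    is_derive s 1 g ('D_v h ((s * t) *: v + p) * t).
  move=> s01; have [/is_derive_line dhs _] := dh _ s01.
  have -> : g = (fun u : R => h (u *: v + p)) \o (t \*: (@id R)).
    by apply/funext => u /=; rewrite /g scalerA mulrC.
  have dst : is_derive s 1 (t \*: (@id R)) t.
    by apply: is_derive_eq; exact: mulr1.
  have dh' : is_derive (t * s) 1 (fun u : R => h (u *: v + p))
      ('D_v h ((s * t) *: v + p)) by rewrite mulrC.
  exact: is_derive1_comp.
have cg : {within `[0, 1], continuous g}.
  apply: derivable_within_continuous => s; rewrite in_itv/= => s01.
  by have [] := dg _ s01.
have [s|s] := @MVT_segment R g (fun s => 'D_v h ((s * t) *: v + p) * t) 0 1
    ler01 _ cg.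
  by rewrite in_itv/= => /andP[s0 s1]; apply: dg; rewrite !ltW.
rewrite in_itv/= => s01; rewrite subr0 mulr1 /g scale1r scale0r add0r => ->.
by rewrite normrM ler_wpM2r//; have [] := dh _ s01.
Qed.

(** Go from [y] to [x] changing one coordinate at a time, with corners [p k], and telescope. A
    sup-norm ball is a box, so this path stays inside it. *)
Lemma partial_le_lipschitz (h : E -> R) (c : E) r eta :
  (forall x, `|c - x| <= r -> forall i,
     derivable h x (e_ i) /\ `|'D_(e_ i) h x| <= eta) ->
  forall x y, `|c - x| <= r -> `|c - y| <= r ->
  `|h x - h y| <= d%:R * eta * `|x - y|.
Proof.
move=> dh x y xr yr; have r0 : 0 <= r := le_trans (normr_ge0 _) xr.
pose p k : E := \row_j (if (j < k)%N then x 0 j else y 0 j).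
have p0 : p 0%N = y by apply/rowP => j; rewrite mxE.
have pd : p d = x by apply/rowP => j; rewrite mxE ltn_ord.
have pS (k : 'I_d) : p k.+1 = (x 0 k - y 0 k) *: e_ k + p k.
  apply/rowP => j; rewrite !mxE/= ltnS leq_eqVlt -val_eqE/=.
  have [/val_inj->|] := eqVneq (val j) (val k); first by rewrite ltnn/=; lra.
  by rewrite mulr0 add0r.
have -> : h x - h y = \sum_(k < d) (h (p k.+1) - h (p k)).
  rewrite -(big_mkord xpredT (fun k => h (p k.+1) - h (p k))).
  by rewrite (@telescope_sumr _ 0 d (h \o p))//= p0 pd.
have -> : d%:R * eta * `|x - y| = \sum_(k < d) eta * `|x - y|.
  by rewrite sumr_const card_ord -[RHS]mulr_natl mulrA.
rewrite (le_trans (ler_norm_sum _ _ _))// ler_sum// => k _; rewrite pS.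
have eta0 : 0 <= eta by have [_] := dh _ xr k; exact: le_trans.
apply: le_trans (_ : eta * `|x 0 k - y 0 k| <= _); last first.
  by rewrite ler_wpM2l//; have := norm_coord_le (x - y) k; rewrite !mxE.
apply: derive_line_le => s /andP[s0 s1]; apply: dh.
apply/rV_norm_leP => // j; rewrite !mxE/=.
have /(rV_norm_leP _ r0)/(_ j) := xr; have /(rV_norm_leP _ r0)/(_ j) := yr.
rewrite !mxE; have [->|_] := eqVneq j k; last first.
  by rewrite mulr0 add0r; case: ifP.
rewrite ltnn mulr1; move: (c 0 k) (x 0 k) (y 0 k) => a b b'.
by rewrite !ler_norml => /andP[? ?] /andP[? ?]; apply/andP; split; nra.
Qed.

Lemma rV_linear_continuous (W : normedModType R) (L : {linear E -> W}) :
  continuous L.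
Proof.
have LC v : `|L v| <= (1 + \sum_(i < d) `|L (e_ i)|) * `|v|.
  rewrite {1}(row_sum_delta v) linear_sum (le_trans (ler_norm_sum _ _ _))//.
  rewrite mulrDl mul1r ler_wpDl// mulr_suml ler_sum// => i _.
  by rewrite linearZ/= normrZ mulrC ler_wpM2l// norm_coord_le.
move: LC; set C := 1 + _ => LC x; apply/continuous_rVP => e e0.
have C0 : 0 < C by rewrite ltr_pwDl// sumr_ge0.
exists (C^-1 * e) => [|y]; first by rewrite mulr_gt0// invr_gt0.
by rewrite ltr_pdivlMl// -linearB => xy; rewrite (le_lt_trans (LC _)).
Qed.

Lemma rV_is_diff (W : normedModType R) (f : E -> W) (x : E)
    (L : {linear E -> W}) :
  (forall e, 0 < e -> exists2 r, 0 < r & forall v, `|v| < r ->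
     `|f (v + x) - f x - L v| <= e * `|v|) ->
  is_diff x f L.
Proof.
move=> fL; apply: is_diff_littleo; first exact: rV_linear_continuous.
move=> e e0; apply/near_rVP; have [r r0 rP] := fL e e0.
by exists r => // v; rewrite sub0r normrN => /rP.
Qed.

(** With [L] the candidate differential, the partial derivatives of [h - L] vanish at [x] and are
    small nearby, so [partial_le_lipschitz] bounds the remainder. *)
Lemma partial_continuous_differentiable (h : E -> R) (x : E) :
  (forall i, \forall y \near x, derivable h y (e_ i)) ->
  (forall i, {for x, continuous ('D_(e_ i) h)}) -> differentiable h x.
Proof.
move=> dh ch; pose l (v : E) : R := \sum_(i < d) v 0 i * 'D_(e_ i) h x.
have l_lin : linear l.
  move=> a u v; rewrite /l scaler_sumr -big_split/=; apply: eq_bigr => i _.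
  by rewrite !mxE mulrDl -mulrA.
have [L LE] : exists L : {linear E -> R}, forall v, L v = l v.
  pose lM := GRing.isLinear.Build _ _ _ _ l l_lin.
  pose L : {linear E -> R} := HB.pack l lM.
  by exists L.
suff : is_diff x h L by [].
(* [partial_le_lipschitz] costs a factor [d]; adding [1] keeps the denominator nonzero for
   [d = 0]. *)
apply: rV_is_diff => e e0; pose eta := e / (d%:R + 1).
have d1 : 0 < (d%:R + 1 : R) by rewrite ltr_wpDl.
have eta0 : 0 < eta by rewrite divr_gt0.
have : \forall y \near x, forall i, derivable h y (e_ i) /\
    `|'D_(e_ i) h x - 'D_(e_ i) h y| < eta.
  apply: (@filter_forall _ _ _ (nbhs x)) => i.
  apply: (@filterI _ (nbhs x)); first exact: dh.
  by apply/near_rVP; exact: (continuous_rVP _ _).1 (ch i) _ eta0.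
move=> /near_rVP[r r0 rP]; exists (r / 2) => [|v vr]; first by rewrite divr_gt0.
pose g : E -> R := h - (L : E -> R).
have dL y i : is_derive y (e_ i) L ('D_(e_ i) h x).
  have dLy := linear_differentiable y (rV_linear_continuous (L := L)).
  split; first exact: diff_derivable.
  rewrite deriveE// (diff_lin y (rV_linear_continuous (L := L)))/= LE /l.
  rewrite (bigD1 i)//= mxE !eqxx mul1r big1 ?addr0// => k ki.
  by rewrite mxE eqxx/= (negbTE ki) mul0r.
have dg y : `|x - y| <= r / 2 -> forall i, derivable g y (e_ i) /\
    `|'D_(e_ i) g y| <= eta.
  move=> xy i; have [|dhy Dhy] := rP y _ i.
    by rewrite (le_lt_trans xy)// ltr_pdivrMr// ltr_pMr// ltr1n.
  have dLy := dL y i; split; first exact: derivableB.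
  by rewrite deriveB// derive_val distrC ltW.
have := partial_le_lipschitz dg (x := v + x) (y := x).
rewrite opprD addrCA subrr addr0 normrN normr0 (ltW vr) divr_ge0 ?(ltW r0)//.
move=> /(_ isT isT); rewrite addrK.
have -> : g (v + x) - g x = h (v + x) - h x - L v.
  rewrite /g !fctE linearD; move: (h (v + x)) (L v) (L x) (h x) => a b c a'.
  by ring.
move=> hle; apply: (le_trans hle); rewrite ler_wpM2r//.
by rewrite /eta mulrCA ler_piMr// ?(ltW e0)// ler_pdivrMr// mul1r lerDl.
Qed.

End C1.


Lemma near_eq_continuous_rV (R : realType) d (V : normedModType R)
    (f g : 'rV[R]_d -> V) (x : 'rV[R]_d) :
  (\forall y \near x, f y = g y) -> {for x, continuous g} ->
  {for x, continuous f}.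
Proof.
move=> /near_rVP[r r0 fg] /continuous_rVP cg; apply/continuous_rVP => e e0.
have [r' r'0 gP] := cg e e0.
exists (Num.min r r') => [|y]; first by rewrite lt_min r0.
rewrite lt_min => /andP[xyr xyr']; rewrite !fg ?subrr ?normr0//.
exact: gP.
Qed.

(** * Contractivity of the extension on a larger cube *)

Section Extension.
Variables (R : realType) (d : nat).
Local Notation E := 'rV[R]_d.
Local Notation O := (@Omega R d).
Local Notation e_ i := (delta_mx 0 i : E).

Definition dcoord (F : E -> E) (s : seq 'I_d) (j : 'I_d) (x : E) : R :=
  dpart s F x 0 j.

Section smooth.
Variables (U : set E) (F : E -> E).
Hypotheses (Uo : open U) (sF : smooth_on U F).

Lemma dcoord_continuous s j x : U x -> {for x, continuous (dcoord F s j)}.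
Proof.
move=> Ux; have [cF _] := sF s Ux.
apply: (@continuous_cvg _ _ _ (nbhs x) _ (dpart s F) (fun y : E => y 0 j)).
  exact: coord_continuous.
exact: cF.
Qed.

Lemma dcoord_is_derive s j x i : U x ->
  is_derive x (e_ i) (dcoord F s j) (dcoord F (i :: s) j x).
Proof.
move=> Ux; have [_ /(_ i) dF] := sF s Ux.
split; first exact: ((derivable_mxP _ _ _).1 dF 0 j).
by rewrite /dcoord/= (derive_mx dF) mxE.
Qed.

(** [smooth_on] only speaks of partial derivatives; this gives the total differentiability that the
    chain rule requires. *)
Lemma dcoord_differentiable s j x : U x -> differentiable (dcoord F s j) x.
Proof.
move=> Ux; have nU : nbhs x U by exact: open_nbhs_nbhs.
apply: partial_continuous_differentiable => i.
  apply: (@filterS _ (nbhs x)) nU => y Uy.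
  by have [] := dcoord_is_derive s j i Uy.
apply: (@near_eq_continuous_rV R d R _ (dcoord F (i :: s) j)); last first.
  exact: dcoord_continuous.
apply: (@filterS _ (nbhs x)) nU => y Uy.
by have [_ ->] := dcoord_is_derive s j i Uy.
Qed.

End smooth.

(** Homothety of ratio [s] about the centre of the cube. *)
Definition dilate (s : R) (x : E) : E := s *: x + (1 - s) *: const_mx 2^-1.

Lemma dilateB s x y : dilate s x - dilate s y = s *: (x - y).
Proof. by rewrite opprD addrACA subrr addr0 scalerBr. Qed.

Lemma dilate1 x : dilate 1 x = x.
Proof. by rewrite /dilate scale1r subrr scale0r addr0. Qed.

Lemma is_derive_dilate (h : E -> R) s x v : differentiable h (dilate s x) ->
  is_derive x v (h \o dilate s) (s * 'D_v h (dilate s x)).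
Proof.
move=> dh; have dd : is_diff x (dilate s) ( *:%R s).
  have := is_diffD (is_diff_scaler s x)
    (is_diff_cst ((1 - s) *: const_mx 2^-1 : E) x).
  by rewrite addr0.
split; first by apply/diff_derivable/differentiable_comp.
rewrite deriveE; last exact: differentiable_comp.
by rewrite diff_comp//= diff_val linearZ/= -deriveE.
Qed.

(** The difference compares the partial derivatives of [F o dilate s] with those of [F]. It is
    jointly continuous in [(x, s)] and zero at [s = 1]; compactness of the cube makes the estimate
    uniform in [x]. *)
Lemma dilation_partial_close (U : set E) (F : E -> E) (eta : R) :
  open U -> O `<=` U -> smooth_on U F -> 0 < eta ->
  \forall s \near (1 : R), forall x, O x -> U (dilate s x) /\
    forall i j, `|s * dcoord F [:: i] j (dilate s x) - dcoord F [:: i] j x| <= eta.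
Proof.
move=> Uo OU sF eta0.
have := (compact_near_coveringP O).1 (@Omega_compact R d) _ (nbhs (1 : R))
  (fun s x => U (dilate s x) /\ forall i j,
    `|s * dcoord F [:: i] j (dilate s x) - dcoord F [:: i] j x| <= eta) _.
apply => x Ox.
have cs : p.2 @[p --> ((x, 1) : E * R)] --> (1 : R) by exact: cvg_snd.
have cx : p.1 @[p --> ((x, 1) : E * R)] --> (x : E) by exact: cvg_fst.
have cd : dilate p.2 p.1 @[p --> ((x, 1) : E * R)] --> (x : E).
  rewrite -[X in _ --> X](dilate1 x).
  apply: cvgD; first exact: cvgZ.
  by apply: cvgZr_tmp; apply: cvgB => //; exact: cvg_cst.
have Ux := OU _ Ox.
have cD i j : (p.2 * dcoord F [:: i] j (dilate p.2 p.1) -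
    dcoord F [:: i] j p.1) @[p --> ((x, 1) : E * R)] --> (0 : R).
  have cdij := @dcoord_continuous _ _ sF [:: i] j _ Ux.
  rewrite -[X in _ --> X](subrr (dcoord F [:: i] j x)).
  rewrite -{1}[dcoord F [:: i] j x]mul1r.
  apply: cvgB; last exact: (@continuous_cvg _ E R _ _ _ _ x cdij cx).
  apply: cvgM => //.
  exact: (@continuous_cvg _ E R _ _ (fun p : E * R => dilate p.2 p.1) _ x cdij cd).
apply: filterI; first by apply: (cd U); exact: open_nbhs_nbhs.
apply: (@filter_forall _ _ _ (nbhs ((x, 1) : E * R))) => i.
apply: (@filter_forall _ _ _ (nbhs ((x, 1) : E * R))) => j.
have := @cvgr_norm_le _ _ _ _ _ _ _ (cD i j) eta.
by rewrite normr0; apply.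
Qed.

(** Points of the larger cube are dilates of points of the cube, and [F o dilate s] is [F] plus a
    map [G] with small partial derivatives. So the Lipschitz constant grows by little, whatever the
    norm. *)
Lemma lipschitz_dilation (N : E -> R) (hN : is_norm N) (U : set E) (F : E -> E)
    (L : R) : open U -> O `<=` U -> smooth_on U F -> 0 <= L < 1 ->
  (forall x y, O x -> O y -> N (F x - F y) <= L * N (x - y)) ->
  exists r L', [/\ 2^-1 < r, 0 <= L' < 1,
    forall x, `|const_mx 2^-1 - x| < r -> U x &
    forall x y, `|const_mx 2^-1 - x| < r -> `|const_mx 2^-1 - y| < r ->
      N (F x - F y) <= L' * N (x - y)].
Proof.
move=> Uo OU sF /andP[L0 L1] FL.
have [C C0 NC] := is_norm_le_norm hN; have [C' C'0 CN] := norm_le_is_norm hN.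
pose K := C * (d%:R * C') + 1.
have K0 : 0 < K by rewrite ltr_wpDl// !mulr_ge0// ltW.
(* Chosen so that [G] contributes at most [(1 - L) / 2] to the Lipschitz constant in [N]. *)
pose eta := (1 - L) / 2 / K.
have eta0 : 0 < eta by rewrite !divr_gt0 ?subr_gt0.
have [rho /= rho0 rhoP] := (nbhs_ballP _ _).1 (dilation_partial_close Uo OU sF eta0).
pose s := 1 + rho / 2; have s1 : 1 < s by rewrite ltrDl divr_gt0.
have {rhoP} sP : forall x, O x -> U (dilate s x) /\
    forall i j, `|s * dcoord F [:: i] j (dilate s x) - dcoord F [:: i] j x| <= eta.
  apply: rhoP; rewrite /ball/= /s opprD addrA subrr sub0r normrN.
  by rewrite ger0_norm ?divr_ge0 ?ltW// ltr_pdivrMr// ltr_pMr// ltr1n.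
have s0 : 0 < s by rewrite (lt_trans ltr01).
pose G x := F (dilate s x) - F x.
have GL x y : O x -> O y -> `|G x - G y| <= d%:R * eta * `|x - y|.
  move=> Ox Oy; have c0 : 0 <= d%:R * eta * `|x - y| by rewrite mulr_ge0// mulr_ge0// ltW.
  apply/(rV_norm_leP _ c0) => j.
  pose g : E -> R := dcoord F [::] j \o dilate s - dcoord F [::] j.
  have -> : (G x - G y) 0 j = g x - g y by rewrite !mxE.
  apply: (@partial_le_lipschitz _ _ g (const_mx 2^-1) 2^-1) => [z /OmegaE Oz i||].
  - have [Uz Dz] := sP _ Oz.
    have d1 := is_derive_dilate (e_ i) (dcoord_differentiable Uo sF [::] j Uz).
    have d2 := dcoord_is_derive sF [::] j i (OU _ Oz).
    have [_ d3] := dcoord_is_derive sF [::] j i Uz.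
    split; first by apply: derivableB.
    by rewrite deriveB// !derive_val d3.
  - exact/OmegaE.
  - exact/OmegaE.
(* [s / 2] is the half-side of the dilated cube, and [(1 + L) / 2 = L + (1 - L) / 2]. Distances grow
   by [s > 1] under dilation, which only helps. *)
exists (s / 2), ((1 + L) / 2).
pose back w := dilate s^-1 w.
have backK w : dilate s (back w) = w.
  apply/rowP => j; rewrite !mxE; field; exact: lt0r_neq0.
have Oback w : `|const_mx 2^-1 - w| < s / 2 -> O (back w).
  move=> wr; apply/OmegaE.
  rewrite (_ : const_mx _ - _ = s^-1 *: (const_mx 2^-1 - w)); last first.
    by apply/rowP => j; rewrite !mxE; field; exact: lt0r_neq0.
  rewrite normrZ ger0_norm ?invr_ge0 ?(ltW s0)// ler_pdivrMl//.
  exact: ltW.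
split.
- by rewrite -[ltLHS]mul1r ltr_pM2r// invr_gt0.
- by apply/andP; split; lra.
- by move=> x /Oback/sP[]; rewrite backK.
move=> x' y' /Oback Ox /Oback Oy.
rewrite -(backK x') -(backK y'); move: {x' y'}(back x') (back y') Ox Oy.
move=> x y Ox Oy; rewrite dilateB (is_norm_homog hN) (ger0_norm (ltW s0)).
have -> : F (dilate s x) - F (dilate s y) = (F x - F y) + (G x - G y).
  by apply/rowP => j; rewrite !mxE; ring.
rewrite (le_trans (is_norm_triangle hN _ _))//.
have Nxy := is_norm_ge0 hN (x - y).
have KG : N (G x - G y) <= (1 - L) / 2 * N (x - y).
  rewrite (le_trans (NC _))//.
  rewrite (le_trans (ler_wpM2l (ltW C0) (GL _ _ Ox Oy)))//.
  rewrite (@le_trans _ _ (C * (d%:R * eta * (C' * N (x - y)))))//.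
    by rewrite ler_pM2l// ler_wpM2l// mulr_ge0// ltW.
  rewrite (_ : C * _ = (C * (d%:R * C')) * eta * N (x - y)); last by ring.
  rewrite ler_wpM2r// /eta mulrCA ler_piMr//; first by lra.
  by rewrite ler_pdivrMr// mul1r lerDl.
apply: (@le_trans _ _ ((1 + L) / 2 * N (x - y))).
  by have FLxy := FL _ _ Ox Oy; nra.
by rewrite ler_wpM2l ?ler_peMl// ?ltW//; lra.
Qed.

End Extension.

(** * Rational expressions in the partial derivatives of [F] *)

Section JetRational.
Variables (R : realType) (d : nat).
Local Notation E := 'rV[R]_d.
Local Notation e_ i := (delta_mx 0 i : E).
Variables (W : set E) (F : E -> E).
Hypotheses (Wo : open W) (sF : smooth_on W F).

(* A class of functions closed under partial derivatives on [W] and containing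
   the entries of [(1 + DF)^-1]. *)
Inductive jet_rational : (E -> R) -> Prop :=
| jet_cst c : jet_rational (fun=> c)
| jet_coord j : jet_rational (fun x => x 0 j)
| jet_dcoord s j : jet_rational (dcoord F s j)
| jet_add f g : jet_rational f -> jet_rational g ->
    jet_rational (fun x => f x + g x)
| jet_mul f g : jet_rational f -> jet_rational g ->
    jet_rational (fun x => f x * g x)
| jet_inv f : jet_rational f -> (forall x, W x -> f x != 0) ->
    jet_rational (fun x => (f x)^-1).

Lemma jet_sum (I : Type) (r : seq I) (f : I -> E -> R) :
  (forall i, jet_rational (f i)) -> jet_rational (fun x => \sum_(i <- r) f i x).
Proof.
move=> jf; elim: r => [|i r IH].
  rewrite (_ : (fun x => _) = (fun=> 0)); first exact: jet_cst.
  by apply/funext => x; rewrite big_nil.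
rewrite (_ : (fun x => _) = (fun x => f i x + \sum_(i <- r) f i x)).
  exact: jet_add.
by apply/funext => x; rewrite big_cons.
Qed.

Lemma jet_prod (I : Type) (r : seq I) (f : I -> E -> R) :
  (forall i, jet_rational (f i)) -> jet_rational (fun x => \prod_(i <- r) f i x).
Proof.
move=> jf; elim: r => [|i r IH].
  rewrite (_ : (fun x => _) = (fun=> 1)); first exact: jet_cst.
  by apply/funext => x; rewrite big_nil.
rewrite (_ : (fun x => _) = (fun x => f i x * \prod_(i <- r) f i x)).
  exact: jet_mul.
by apply/funext => x; rewrite big_cons.
Qed.

Lemma jet_det n (A : E -> 'M[R]_n) :
  (forall i j, jet_rational (fun x => A x i j)) ->
  jet_rational (fun x => \det (A x)).
Proof.
move=> jA; apply: jet_sum => s; apply: jet_mul; first exact: jet_cst.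
exact: jet_prod.
Qed.

(** Cramer's rule; the determinant is an admissible denominator since it does not vanish on [W]. *)
Lemma jet_invmx n (A : E -> 'M[R]_n) :
  (forall i j, jet_rational (fun x => A x i j)) ->
  (forall x, W x -> A x \in unitmx) ->
  forall i j, exists2 g, jet_rational g & forall x, W x -> invmx (A x) i j = g x.
Proof.
move=> jA uA i j; exists (fun x => (\det (A x))^-1 * cofactor (A x) j i).
  apply: jet_mul.
    apply: jet_inv => [|x Wx]; first exact: jet_det.
    by rewrite -unitfE -unitmxE uA.
  apply: jet_mul; first exact: jet_cst.
  apply: jet_det => i' j'.
  rewrite (_ : (fun x => _) = (fun x => A x (lift j i') (lift i j')))//.
  by apply/funext => x; rewrite !mxE.
by move=> x Wx; rewrite /invmx uA// !mxE.
Qed.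

Lemma jet_differentiable h x : jet_rational h -> W x -> differentiable h x.
Proof.
move=> jh Wx; elim: jh => {h} [c|j|s j|f g _ df _ dg|f g _ df _ dg|f _ df f0].
- exact: differentiable_cst.
- exact: differentiable_coord.
- exact: (dcoord_differentiable Wo).
- exact: differentiableD.
- exact: differentiableM.
- by apply: differentiableV => //; exact: f0.
Qed.

Lemma jet_derive h i : jet_rational h -> exists2 g, jet_rational g &
  forall x, W x -> 'D_(e_ i) h x = g x.
Proof.
have dv f x : jet_rational f -> W x -> derivable f x (e_ i).
  by move=> jf Wx; apply: diff_derivable; exact: jet_differentiable.
elim=> {h} [c|j|s j|f g jf [f' jf' ff'] jg [g' jg' gg']
  |f g jf [f' jf' ff'] jg [g' jg' gg']|f jf [f' jf' ff'] f0].
- exists (fun=> 0); first exact: jet_cst.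
  by move=> x _; exact: derive_cst.
- exists (fun=> (e_ i) 0 j); first exact: jet_cst.
  move=> x _; have := derive_mx (@derivable_id R E x (e_ i)).
  by rewrite derive_id => /(congr1 (fun A : E => A 0 j)); rewrite !mxE => ->.
- exists (dcoord F (i :: s) j); first exact: jet_dcoord.
  by move=> x Wx; have [_ ->] := dcoord_is_derive sF s j i Wx.
- exists (fun x => f' x + g' x); first exact: jet_add.
  by move=> x Wx; rewrite (deriveD (dv _ _ jf Wx) (dv _ _ jg Wx)) ff'// gg'.
- exists (fun x => f x * g' x + g x * f' x).
    by apply: jet_add; exact: jet_mul.
  by move=> x Wx; rewrite (deriveM (dv _ _ jf Wx) (dv _ _ jg Wx)) ff'// gg'.
- exists (fun x => -1 * ((f x)^-1 * (f x)^-1) * f' x).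
    do 2?[apply: jet_mul => //]; first exact: jet_cst.
    by apply: jet_mul; exact: jet_inv.
  move=> x Wx; rewrite (deriveV (f0 _ Wx) (dv _ _ jf Wx)) ff'//.
  by rewrite mulN1r -invfM -expr2.
Qed.

End JetRational.

(** * Smoothness of the inverse of [id + F] *)

Section InverseFunction.
Variables (R : realType) (d : nat).
Local Notation E := 'rV[R]_d.
Local Notation e_ i := (delta_mx 0 i : E).

Lemma rV_differentiable_coord (V : normedModType R) (f : V -> E) (x : V) :
  (forall j, differentiable (fun y => f y 0 j) x) -> differentiable f x.
Proof.
move=> df; rewrite (_ : f = \sum_(j < d) (fun y => f y 0 j *: e_ j)).
  by apply: differentiable_sum => j; exact: differentiableZl.
by apply/funext => y; rewrite fct_sumE -row_sum_delta.
Qed.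

Lemma is_diff_rV (V : normedModType R) (f df : E -> V) (x : E) (e : R) :
  is_diff x f df -> 0 < e -> exists2 r, 0 < r & forall v, `|v| < r ->
    `|f (v + x) - f x - df v| <= e * `|v|.
Proof.
move=> [dfx <-] e0; have /eqaddoP/(_ e e0)/near_rVP[r r0 rP] := diff_locally dfx.
exists r => // v vr; have := rP v; rewrite sub0r normrN => /(_ vr).
by rewrite !fctE/= opprD addrA.
Qed.

Variables (N : E -> R) (hN : is_norm N) (W : set E) (F : E -> E) (L : R).
Hypotheses (Wo : open W) (sF : smooth_on W F) (L01 : 0 <= L < 1).
Hypothesis FL : forall x y, W x -> W y -> N (F x - F y) <= L * N (x - y).
Local Notation phi := (fun x => x + F x).

Let L1 : 0 < 1 - L. Proof. by have /andP[] := L01; lra. Qed.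

(** For [y] near [x0 + F x0], a preimage is a fixed point of [x |-> y - F x] on a closed [N]-ball
    around [x0] contained in [W]. *)
Lemma open_image_id_add : open (phi @` W).
Proof.
have [C C0 NC] := is_norm_le_norm hN; have [C' C'0 CN] := norm_le_is_norm hN.
rewrite openE => _ [x0 Wx0 <-].
have /near_rVP[r r0 rW] : nbhs x0 W by exact: open_nbhs_nbhs.
pose rho := r / (2 * C').
have rho0 : 0 < rho by rewrite divr_gt0// mulr_gt0.
pose K := [set x | N (x0 - x) <= rho].
have KW x : K x -> `|x0 - x| < r.
  move=> Kx; rewrite (le_lt_trans (CN _))// mulrC -ltr_pdivlMr//.
  rewrite (le_lt_trans Kx)// /rho invfM mulrA ltr_pM2r ?invr_gt0//.
  by rewrite ltr_pdivrMr// ltr_pMr// ltr1n.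
have cK : compact K.
  apply: subclosed_compact (@compact_closed_ballrV R d x0 r) _; last first.
    by move=> x /KW/ltW.
  apply: (@closed_comp E R (fun x : E => N (x0 - x)) [set t | t <= rho]).
    move=> x _; apply: (@continuous_cvg _ E R (nbhs x) _ (fun y => x0 - y) N).
      exact: is_norm_continuous.
    by apply: cvgB; [exact: cvg_cst|exact: cvg_id].
  exact: closed_le.
(* Then [y] is within [(1 - L) rho] of [phi x0] in [N]; the contraction adds at most [L rho], so the
   ball of radius [rho] is mapped to itself. *)
apply/near_rVP; exists ((1 - L) * rho / C) => [|y xy].
  by rewrite divr_gt0// mulr_gt0.
have {}xy : N (y - phi x0) <= (1 - L) * rho.
  rewrite (le_trans (NC _))// mulrC -ler_pdivlMr// distrC ltW//.
have K0 : K !=set0 by exists x0; rewrite /K/= subrr (is_norm0 hN) ltW.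
have [x Kx||x z Kx Kz|x Kx Tx] := contraction_fixed_point hN K0 cK
    (T := fun x => y - F x) (c := L).
- rewrite /K/= (is_norm_distC hN).
  rewrite (_ : _ - x0 = (y - phi x0) - (F x - F x0)); last first.
    by apply/rowP => j; rewrite !mxE; ring.
  rewrite (le_trans (is_norm_triangle hN _ _))// (is_normN hN).
  have := FL (rW _ (KW _ Kx)) Wx0; rewrite (is_norm_distC hN x).
  have /andP[L0 _] := L01; have := ler_wpM2l L0 Kx; lra.
- by have /andP[] := L01.
- rewrite /= (_ : _ - (y - F z) = - (F x - F z)); last first.
    by apply/rowP => j; rewrite !mxE; ring.
  by rewrite (is_normN hN) FL//; exact/rW/KW.
by exists x; [exact/rW/KW|rewrite -{1}Tx subrK].
Qed.

(** Row [i] is the derivative in direction [e_i], so the differential acts on row vectors by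
    multiplication on the right. *)
Definition id_add_jacobian x : 'M[R]_d :=
  \matrix_(i, j) ((i == j)%:R + dcoord F [:: i] j x).

Lemma id_add_is_diff x : W x -> is_diff x phi (mulmxr (id_add_jacobian x)).
Proof.
move=> Wx; have dF : differentiable F x.
  by apply: rV_differentiable_coord => j; exact: (dcoord_differentiable Wo sF [::] j).
have dphi : differentiable (phi : E -> E) x by exact: differentiableD.
split=> //; apply/funext => v; rewrite -deriveE// deriveEjacobian//=.
congr (_ *m _); apply/matrixP => i j; rewrite [RHS]mxE.
transitivity ((e_ i *m jacobian (phi : E -> E) x) 0 j).
  by rewrite -rowE [RHS]mxE.
rewrite -deriveEjacobian// deriveD//; last exact: diff_derivable.
by rewrite derive_id !mxE eqxx eq_sym.
Qed.

(** Along a kernel vector [v], [phi] would move by [o(t)] only, whereas [expansive_add] forces a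
    displacement of at least [(1 - L) t N v]. *)
Lemma id_add_jacobian_unit x : W x -> id_add_jacobian x \in unitmx.
Proof.
move=> Wx; rewrite -row_free_unit -kermx_eq0; apply/rowV0P => v /sub_kermxP vA.
apply/eqP/negP => /negP v0.
have [C C0 NC] := is_norm_le_norm hN.
have Nv : 0 < N v.
  rewrite lt_neqAle (is_norm_ge0 hN) andbT eq_sym.
  by apply/eqP => /(is_norm_eq0 hN)/eqP; apply/negP.
have nv : 0 < `|v| by rewrite normr_gt0.
have [dphi dphiE] := id_add_is_diff Wx.
(* With this tolerance the linearization error, measured in [N], is at most half of the expansive
   lower bound. *)
have e0 : 0 < (1 - L) * N v / (2 * C * `|v|).
  by rewrite divr_gt0// !mulr_gt0.
have [r r0 rP] := is_diff_rV (id_add_is_diff Wx) e0.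
have /near_rVP[r' r'0 rW] : nbhs x W by exact: open_nbhs_nbhs.
pose t := Num.min r r' / 2 / `|v|.
have m0 : 0 < Num.min r r' by rewrite lt_min r0.
have t0 : 0 < t by rewrite !divr_gt0.
have tv : `|t *: v| < Num.min r r'.
  rewrite normrZ (gtr0_norm t0) /t divfK ?gt_eqF//.
  by rewrite ltr_pdivrMr// ltr_pMr// ltr1n.
move: tv; rewrite lt_min => /andP[tvr tvr'].
have Wtv : W (t *: v + x).
  by apply: rW; rewrite opprD addrCA subrr addr0 normrN.
have := rP _ tvr; rewrite /= -scalemxAl vA scaler0 subr0.
rewrite normrZ (gtr0_norm t0) => le1.
have := expansive_add hN (FL Wtv Wx); rewrite addrK (is_norm_homog hN).
rewrite (gtr0_norm t0) => le2.
have := le_trans le2 (le_trans (NC _) (ler_wpM2l (ltW C0) le1)).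
rewrite (_ : C * _ = (1 - L) * (t * N v) / 2); last first.
  by field; rewrite !gt_eqF.
have := mulr_gt0 L1 (mulr_gt0 t0 Nv); lra.
Qed.

Variable psi : E -> E.
Hypothesis psiP : forall y, (phi @` W) y -> W (psi y) /\ phi (psi y) = y.

(** For [z = psi (v + y)], the remainder of [psi] is the remainder of [phi] at [x], multiplied by
    the inverse Jacobian up to sign. It is small relative to [|z - x|], and [|z - x| <= K |v|]. *)
Lemma id_add_inverse_is_diff y : (phi @` W) y ->
  is_diff y psi (mulmxr (invmx (id_add_jacobian (psi y)))).
Proof.
move=> Vy; have [Wx xy] := psiP Vy; set x := psi y in Wx xy *.
have [C C0 NC] := is_norm_le_norm hN; have [C' C'0 CN] := norm_le_is_norm hN.
set A := id_add_jacobian x; have uA : A \in unitmx by exact: id_add_jacobian_unit.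
have [k k0 kP] := linear_lipschitz (rV_linear_continuous (L := mulmxr (invmx A))).
apply: rV_is_diff => e e0.
pose K := C' * ((1 - L)^-1 * C).
have K0 : 0 < K by rewrite !mulr_gt0// invr_gt0.
have eta0 : 0 < e / (k * K) by rewrite divr_gt0// mulr_gt0.
have [r r0 rP] := is_diff_rV (id_add_is_diff Wx) eta0.
have /near_rVP[r' r'0 rV] : nbhs y (phi @` W).
  by apply: open_nbhs_nbhs; split => //; exact: open_image_id_add.
exists (Num.min (r / K) r') => [|v]; first by rewrite lt_min divr_gt0.
rewrite lt_min => /andP[vr vr'].
have Vvy : (phi @` W) (v + y).
  by apply: rV; rewrite opprD addrCA subrr addr0 normrN.
have [Wz zvy] := psiP Vvy; set z := psi (v + y) in Wz zvy *.
have zxv : `|z - x| <= K * `|v|.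
  rewrite (le_trans (CN _))// -!mulrA ler_pM2l// ler_pdivlMl//.
  by rewrite (le_trans (expansive_add hN (FL Wz Wx)))// zvy xy addrK NC.
have zxr : `|z - x| < r.
  by rewrite (le_lt_trans zxv)// mulrC -ltr_pdivlMr.
have := rP _ zxr; rewrite subrK zvy xy addrK/= => le1.
have -> : z - x - v *m invmx A = - mulmxr (invmx A) (v - (z - x) *m A).
  by rewrite /= mulmxBl mulmxK// opprB.
rewrite normrN (le_trans (kP _))// (le_trans (ler_wpM2l (ltW k0) le1))//.
rewrite (le_trans (ler_wpM2l (ltW k0) (ler_wpM2l (ltW eta0) zxv)))//.
rewrite (_ : k * (_ * _) = e * `|v|)//; by field; rewrite !gt_eqF.
Qed.

Lemma jet_comp_inverse h y : jet_rational W F h -> (phi @` W) y ->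
  differentiable (h \o psi) y.
Proof.
move=> jh Vy; have [Wx _] := psiP Vy; have [dpsi _] := id_add_inverse_is_diff Vy.
by apply: differentiable_comp => //; exact: (jet_differentiable Wo sF).
Qed.

(** Chain rule: row [i] of the inverse Jacobian is paired with the gradient of [h], and both have
    jet-rational entries on [W]. *)
Lemma jet_comp_inverse_derive h i : jet_rational W F h ->
  exists2 g, jet_rational W F g &
    forall y, (phi @` W) y -> 'D_(e_ i) (h \o psi) y = g (psi y).
Proof.
move=> jh.
have /choice[B BP] : forall j, exists g, jet_rational W F g /\
    forall x, W x -> invmx (id_add_jacobian x) i j = g x.
  move=> j; have [||g jg gP] := @jet_invmx R d W F d id_add_jacobian _ _ i j.
  - move=> i' j'; rewrite (_ : (fun x => _) =
      (fun x => (i' == j')%:R + dcoord F [:: i'] j' x)).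
      by apply: jet_add; [exact: jet_cst|exact: jet_dcoord].
    by apply/funext => x; rewrite mxE.
  - by move=> x Wx; exact: id_add_jacobian_unit.
  - by exists g.
have /choice[D DP] : forall j, exists g, jet_rational W F g /\
    forall x, W x -> 'D_(e_ j) h x = g x.
  by move=> j; have [g jg gP] := jet_derive Wo sF j jh; exists g.
exists (fun x => \sum_j B j x * D j x).
  apply: jet_sum => j; apply: jet_mul; first by have [] := BP j.
  by have [] := DP j.
move=> y Vy; have [Wx _] := psiP Vy; have dpsi := id_add_inverse_is_diff Vy.
have dh := jet_differentiable Wo sF jh Wx.
rewrite deriveE; last exact: jet_comp_inverse.
rewrite diff_comp//= diff_val/= [X in 'd h _ X]row_sum_delta linear_sum.
apply: eq_bigr => j _; rewrite linearZ/= -deriveE//.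
have [_ <-] := BP j; last by [].
have [_ <-] := DP j; last by [].
by rewrite -rowE mxE.
Qed.

Lemma near_image_id_add y : (phi @` W) y -> nbhs y (phi @` W).
Proof.
by move=> Vy; apply: open_nbhs_nbhs; split => //; exact: open_image_id_add.
Qed.

(** The induction carries the form of the derivative, not just its existence, so each further order
    needs only one first-order derivative. *)
Lemma dpart_inverse s : exists2 h : 'I_d -> E -> R,
  forall j, jet_rational W F (h j) &
  forall y, (phi @` W) y -> dpart s psi y = \row_j h j (psi y).
Proof.
elim: s => [|i s [h jh hP]].
  exists (fun j x => x 0 j) => [j|y _]; first exact: jet_coord.
  by apply/rowP => j; rewrite mxE.
have /choice[h' h'P] : forall j, exists g, jet_rational W F g /\
    forall y, (phi @` W) y -> 'D_(e_ i) (h j \o psi) y = g (psi y).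
  by move=> j; have [g jg gP] := jet_comp_inverse_derive i (jh j); exists g.
exists h' => [j|y Vy]; first by have [] := h'P j.
rewrite /= (@near_eq_derive _ _ _ _ (fun z => \row_j h j (psi z))); last first.
  by apply: (@filterS _ (nbhs y)) (near_image_id_add Vy).
have dH : differentiable (fun z => \row_j h j (psi z)) y.
  apply: rV_differentiable_coord => j.
  rewrite (_ : (fun _ => _) = h j \o psi); first exact: jet_comp_inverse.
  by apply/funext => z; rewrite mxE.
rewrite derive_mx; last exact: diff_derivable.
apply/rowP => j; rewrite !mxE; have [_ <-//] := h'P j.
by congr ('D_ _ _ _); apply/funext => z; rewrite mxE.
Qed.

Lemma smooth_on_inverse : smooth_on (phi @` W) psi.
Proof.
move=> s y Vy; have [h jh hP] := dpart_inverse s.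
have hE : \forall z \near y, dpart s psi z = \row_j h j (psi z).
  by apply: (@filterS _ (nbhs y)) (near_image_id_add Vy).
have dH : differentiable (fun z => \row_j h j (psi z)) y.
  apply: rV_differentiable_coord => j.
  rewrite (_ : (fun _ => _) = h j \o psi); first exact: jet_comp_inverse.
  by apply/funext => z; rewrite mxE.
split=> [|i].
  apply: (@near_eq_continuous_rV R d E _ (fun z => \row_j h j (psi z))) => //.
  exact: differentiable_continuous.
apply: near_eq_derivable; last exact: (diff_derivable dH).
by apply: (@filterS _ (nbhs y)) hE => z ->.
Qed.

End InverseFunction.

(** * Diffeomorphisms from [V1], and the path to the identity *)

Section Main.
Variables (R : realType) (d : nat).
Local Notation E := 'rV[R]_d.
Local Notation O := (@Omega R d).
Local Notation Did := (Diff_id R d).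

Lemma Omega_val (x : O) : O (val x).
Proof. exact: set_mem (valP x). Qed.

Lemma partial_scale_add (t : R) (f g : Cinf R d) s (x : O) :
  partial s (t *: f + g) x = t *: partial s f x + partial s g x.
Proof.
have /smoothP[F fF] := CinfP f; have /smoothP[G gG] := CinfP g.
have fg : smooth_ext (t *: f + g : Cinf R d) (t *: F + G).
  exact: (smooth_ext_linear t fF gG).
rewrite (partialE fg) (partialE fF) (partialE gG).
have [U [Uo OU sF _]] := fF; have [V [Vo OV sG _]] := gG.
apply: (@dpart_linear _ _ t (U `&` V)) => //; first exact: openI.
- by apply: smooth_on_subset sF => ? [].
- by apply: smooth_on_subset sG => ? [].
- by split; [exact/OU/Omega_val|exact/OV/Omega_val].
Qed.

Lemma partial_bounded (f : Cinf R d) s :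
  exists2 M, 0 < M & forall x : O, `|partial s f x| <= M.
Proof.
have /smoothP[F fF] := CinfP f; have [U [Uo OU sF _]] := fF.
have cF : {within O, continuous (dpart s F)}.
  apply: continuous_within_rVP => x Ox e e0.
  have [/continuous_rVP/(_ e e0)[r r0 rP] _] := sF s x (OU _ Ox).
  by exists r => // y _; exact: rP.
have /ex_strict_bound_gt0[M M0 FM] : bounded_set (dpart s F @` O).
  exact/compact_bounded/continuous_compact/Omega_compact.
exists M => // x; rewrite (partialE fF) ltW//; apply: FM.
by exists (val x) => //; exact: Omega_val.
Qed.

Lemma Diff_Cinf_inj : injective (@Diff_Cinf R d).
Proof.
move=> p q /(congr1 (@Cinf_fun R d)) /= pq; apply/val_inj/funext => x /=.
by apply/val_inj; exact: (congr1 (fun h => h x) pq).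
Qed.

(** The topology is initial for the jet, so one partial derivative is treated at a time. Its
    increment is a scalar increment of [u] times a function bounded on the cube, hence uniformly
    small. *)
Lemma Cinf_line_continuous (u : R -> R) (f g : Cinf R d) : continuous u ->
  continuous (fun t => u t *: f + g : Cinf R d).
Proof.
move=> cu; apply: (@continuous_comp_initial _ _ _ (@jet R d)) => t.
apply/cvg_sup => s A [_ [[B Bo <-] Bt] /filterS]; apply.
have /uniform_nbhs[V [entV VB]] :
    nbhs (partial s (u t *: f + g) : {uniform O -> E}) B.
  exact: open_nbhs_nbhs.
have [M M0 fM] := partial_bounded f s.
move: entV; rewrite -entourage_ballE => -[e /= e0 eV].
have eM0 : 0 < e / M by rewrite divr_gt0.
have /cvgrPdist_lt/(_ _ eM0) := cu t; apply: filterS => t' tt'.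
apply: VB => x _; apply: eV => /=; rewrite -ball_normE/=.
rewrite /proj/jet !partial_scale_add opprD addrACA subrr addr0 -scalerBl.
rewrite normrZ (le_lt_trans (ler_wpM2l (normr_ge0 _) (fM x)))//.
by rewrite -ltr_pdivlMr.
Qed.

Lemma Diff_line_continuous (f : Cinf R d) (Phi : R -> Diff R d) :
  (forall t, Diff_Cinf (Phi t) = clip01 t *: f + Diff_Cinf Did) ->
  continuous Phi.
Proof.
move=> PhiE; apply: (@continuous_comp_initial _ _ _ (@Diff_Cinf R d)).
rewrite (_ : _ \o _ = fun t => clip01 t *: f + Diff_Cinf Did); last exact/funext.
apply: Cinf_line_continuous => t; apply/cvgrPdist_le => e e0.
have /cvgrPdist_le/(_ e e0) : (id : R -> R) @ t --> t by exact: cvg_id.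
apply: filterS => s.
exact/le_trans/clip01_dist.
Qed.

Lemma Lip_lt1P (N : E -> R) (f : O -> E) : (Lip N f < 1)%E ->
  exists2 L, 0 <= L < 1 & forall x y, N (f x - f y) <= L * N (val x - val y).
Proof.
move=> /ereal_inf_lt[_ [L [L0 fL] <-]]; rewrite lte_fin => L1.
by exists L; rewrite ?L0.
Qed.

Lemma V1_scale (N : E -> R) (hN : is_norm N) (f : Cinf R d) t : 0 <= t <= 1 ->
  V1 N f -> V1 N (t *: f).
Proof.
move=> /andP[t0 t1] [tf /Lip_lt1P[L /andP[L0 L1] fL]]; split.
  move=> x j xj; rewrite -[LHS]/((t *: f x) 0 j) mxE tf ?mulr0//.
apply: (@le_lt_trans _ _ L%:E); last by rewrite lte_fin.
apply: ereal_inf_lbound; exists L => //; split => // x y.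
rewrite -[X in N X]/(t *: f x - t *: f y) -scalerBr (is_norm_homog hN).
rewrite ger0_norm// (le_trans _ (fL x y))// ler_piMl//.
exact: is_norm_ge0.
Qed.

(** [cube_bijective] makes the cube its own image, and [smooth_on_inverse] provides a smooth inverse
    on the open image [V] of the larger cube [W]; the latter extends the inverse on the cube. *)
Lemma V1_diffeo (N : E -> R) (hN : is_norm N) (f : Cinf R d) : V1 N f ->
  exists p : Diff R d, Diff_Cinf p = f + Diff_Cinf Did.
Proof.
move=> [tf /Lip_lt1P[L L01 fL]].
have /smoothP[F fF] := CinfP f; have [U [Uo OU sF Ff]] := fF.
have O_ex (x : E) : O x -> exists y : O, val y = x.
  by move=> Ox; exists (exist _ x (mem_set Ox)).
have FL x y : O x -> O y -> N (F x - F y) <= L * N (x - y).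
  by move=> /O_ex[{}x <-] /O_ex[{}y <-]; rewrite !Ff.
have tF : tangent F.
  by move=> x /O_ex[{}x <-] j xj; rewrite Ff; exact: tf.
have [phiO phi_surj] := cube_bijective hN L01 tF FL.
have [r [L' [r_gt L'01 WU WL]]] := lipschitz_dilation hN Uo OU sF L01 FL.
pose W := [set x : E | `|const_mx 2^-1 - x| < r].
have Wo : open W.
  have -> : W = ball (const_mx 2^-1 : E) r by rewrite -ball_normE.
  exact: ball_open.
have sFW : smooth_on W F by apply: smooth_on_subset sF; exact: WU.
have OW : O `<=` W by move=> x /OmegaE xr; rewrite /W/= (le_lt_trans xr).
pose V := [set x + F x | x in W].
have /choice[psi psiP] : forall y, exists x, V y -> W x /\ x + F x = y.
  move=> y; have [[x Wx xy]|nVy] := pselect (V y); first by exists x.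
  by exists 0 => /nVy.
have psiK x : W x -> psi (x + F x) = x.
  move=> Wx; have [|Wpx ppx] := psiP (x + F x); first by exists x.
  apply/eqP; rewrite -subr_eq0; apply/eqP/(is_norm_eq0 hN).
  have := expansive_add hN (WL _ _ Wpx Wx); rewrite ppx subrr (is_norm0 hN).
  by have := is_norm_ge0 hN (psi (x + F x) - x); have /andP[] := L'01; nra.
(* Injectivity on [W] identifies [psi y] with the preimage of [y] found in the cube. *)
have psiO y : O y -> O (psi y) /\ psi y + F (psi y) = y.
  by move=> /phi_surj[x Ox <-]; rewrite psiK//; exact: OW.
have OV : O `<=` V by move=> y /phi_surj[x /OW Wx xy]; exists x.
pose ph (x : O) : O :=
  exist (fun z => z \in O) _ (mem_set (phiO _ (Omega_val x))).
pose ps (y : O) : O :=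
  exist (fun z => z \in O) _ (mem_set (psiO _ (Omega_val y)).1).
have phsmooth : (val \o ph : O -> E) \in @smooth R d.
  have -> : (val \o ph : O -> E) = (f + Diff_Cinf Did : Cinf R d).
    by apply/funext => x /=; rewrite Ff addrC.
  exact: CinfP.
have phdiff : ph \in @diffeo R d.
  apply/diffeoP; exists ps; split => //.
  - by move=> x; apply/val_inj => /=; rewrite psiK//; exact/OW/Omega_val.
  - by move=> y; apply/val_inj => /=; have [_] := psiO _ (Omega_val y).
  - apply/smoothP; exists psi, V; split => //.
      exact: (open_image_id_add hN Wo L'01 WL).
    exact: (smooth_on_inverse hN Wo sFW L'01 WL psiP).
exists (MkDiff phdiff); apply/val_inj/funext => x /=.
by rewrite Ff addrC.
Qed.

End Main.

Theorem proposition3p4 (R : realType) (d : nat)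
    (N : 'rV[R]_d -> R) (hN : is_norm N) :
  (forall f : Cinf R d, V1 N f ->
     range (@Diff_Cinf R d) (f + Diff_Cinf (Diff_id R d))) /\
  V1 N `<=` @kappa R d @` Diff0 R d.
Proof.
split=> [f /(V1_diffeo hN)[p pf]|f fV1]; first by exists p.
have /choice[Phi PhiE] : forall t, exists p : Diff R d,
    Diff_Cinf p = clip01 t *: f + Diff_Cinf (Diff_id R d).
  by move=> t; apply: (V1_diffeo hN); apply: V1_scale => //; exact: clip01_itv.
have Phi0 : Phi 0 = Diff_id R d.
  apply: Diff_Cinf_inj; rewrite PhiE /clip01 (min_r ler01) max_l//.
  by rewrite scale0r add0r.
exists (Phi 1); last first.
  rewrite /kappa PhiE /clip01 minxx (max_r ler01) scale1r.
  by rewrite addrK.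
have cPhi := Diff_line_continuous PhiE.
(* The image of the path is a connected set containing both [Diff_id] and [Phi 1]. *)
apply: (@connected_component_max _ _ (Phi @` `[0, 1])) => //.
- by exists 0 => //=; rewrite in_itv/= lexx ler01.
- apply: connected_continuous_connected; first exact: segment_connected.
  exact: continuous_subspaceT.
- by exists 1 => //=; rewrite in_itv/= lexx ler01.
Qed.
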